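(* Let $E=\mathbb{Q}(\sqrt{-2})$ and $\mathfrak{O}=\mathbb{Z}[\sqrt{-2}]$. The Hermitian $\mathfrak{O}$-lattice $\langle 1,1\rangle\perp\begin{pmatrix}2&-1+\sqrt{-2}\\-1-\sqrt{-2}&2\end{pmatrix}$ is $2$-universal.
   Context: A Hermitian $\mathfrak{O}$-lattice is a finitely generated $\mathfrak{O}$-submodule $L$ of a finite-dimensional $E$-vector space equipped with a form $H$ that is linear in the first variable, satisfies $H(x,y)=\overline{H(y,x)}$ (bar is complex conjugation), and has $H(L,L)\subseteq\mathfrak{O}$. Its rank is $\dim_E EL$; binary means rank 2. It is positive (definite) if $H(v):=H(v,v)>0$ for all $0\neq v\in L$. Here every lattice is free ($\mathfrak{O}$ is a PID); the Gram matrix of a lattice with basis $v_1,\dots,v_n$ is $M_L=(H(v_i,v_j))$, and a lattice is identified with its Gram matrix. $\langle a_1,\dots,a_n\rangle$ denotes the lattice with diagonal Gram matrix with entries $a_1,\dots,a_n$, and $\perp$ denotes orthogonal sum. $L$ represents $\ell$ if $M_\ell=XM_LX^*$ for some matrix $X$ over $\mathfrak{O}$, where $X^*$ is the conjugate transpose. A positive Hermitian $\mathfrak{O}$-lattice is $2$-universal if it represents all binary positive Hermitian $\mathfrak{O}$-lattices. *)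

(* Defs.v *)
From HB Require Import structures.
From mathcomp Require Import all_boot all_order all_algebra all_field.

Set Implicit Arguments.
Unset Strict Implicit.
Unset Printing Implicit Defensive.

Import Order.TTheory GRing.Theory Num.Theory.
Local Open Scope ring_scope.
Local Open Scope sesquilinear_scope.

(* The field Q(sqrt(-2)) and its ring of integers are taken inside algC, so   *)
(* that the bar involution is complex conjugation, the library's conjC. The   *)
(* order on algC is partial: [0 < z] says that z is real and positive.        *)
Definition sqrtm2 : algC := sqrtC (- 2).

(* Z[sqrt(-2)] is the Z-span of 1 and sqrt(-2).                               *)
Definition Zsqrtm2 : {pred algC} := Cint_span [:: 1; sqrtm2].

(* A Hermitian Z[sqrt(-2)]-lattice of rank n is identified with its Gram      *)
(* matrix M in a basis v_1, .., v_n. As the form is linear in its first       *)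
(* variable, H (\sum_i x_i v_i) (\sum_j y_j v_j) = x *m M *m y^t* for         *)
(* coordinate row vectors x and y.                                            *)
Definition hermitian_lattice n (M : 'M[algC]_n) : Prop :=
  M \is a mxOver Zsqrtm2 /\ M \is hermsymmx.

Definition hform n (M : 'M[algC]_n) (x y : 'rV[algC]_n) : algC :=
  (x *m M *m y^t*) 0 0.

Definition positive_lattice n (M : 'M[algC]_n) : Prop :=
  hermitian_lattice M /\
  forall x : 'rV[algC]_n, x \is a mxOver Zsqrtm2 -> x != 0 -> 0 < hform M x x.

Definition represents m n (L : 'M[algC]_m) (l : 'M[algC]_n) : Prop :=
  exists2 X : 'M[algC]_(n, m), X \is a mxOver Zsqrtm2 & l = X *m L *m X^t*.

Definition two_universal m (L : 'M[algC]_m) : Prop :=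
  positive_lattice L /\
  forall l : 'M[algC]_2, positive_lattice l -> represents L l.

Definition diag_lattice (a : seq algC) : 'M[algC]_(size a) :=
  diag_mx (\row_i a`_i).

Definition orthogonal_sum m n (L : 'M[algC]_m) (M : 'M[algC]_n) :
    'M[algC]_(m + n) :=
  block_mx L 0 0 M.

Definition mx22 (a b c d : algC) : 'M[algC]_2 :=
  \matrix_(i, j) if i == 0 then (if j == 0 then a else b)
                 else (if j == 0 then c else d).

(* Main.v *)
Require Import Defs.
From HB Require Import structures.
From mathcomp Require Import all_boot all_order all_algebra all_field.
From mathcomp Require Import zify ring.

Set Implicit Arguments.
Unset Strict Implicit.
Unset Printing Implicit Defensive.

Import Order.TTheory GRing.Theory Num.Theory.
Local Open Scope ring_scope.

(** Write w for the square root of -2, O for Z[w], I3 for <1,1,1>, M for the even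
    unimodular plane of the statement and L for <1,1> + M.

    Every positive binary lattice l is represented by I3 or by <1> + M.  One
    enlarges l as long as it stays integral; this divides its discriminant, so
    it stops.  For the last lattice l the discriminant d is odd and squarefree
    and l is nonzero modulo every prime dividing d ([overlattice_even],
    [overlattice_square], [overlattice_content]).  Bordering the Gram matrix of
    l by a column u and an integer e gives determinant e d - Q(u), where Q is
    the adjugate form, so determinant 1 can be reached exactly when Q takes the
    value -1 modulo d.  Modulo a prime dividing d this is easy, because the norm
    form x^2 + 2y^2 takes all values modulo an odd prime, and the Chinese
    remainder theorem does the rest ([adj_form_solution]).  The bordered matrix
    is a positive unimodular ternary lattice, and reduction theory shows that
    the only such lattices are I3 and <1> + M ([unimodular3_class]): since any
    complex number is at squared distance at most 3/4 from O, a reduced lattice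
    has minimum a with a^3 <= 64, and integrality of the remaining Gram entries
    excludes a = 2, 3, 4.

    The lattice <1> + M is contained in L, but I3 is not; I3 and <1> + M lie in
    the same genus, and a lattice l in I3 is moved into L as follows.  Let
    pi = 1 + w, of norm 3.  The vector (1,1,1)/conj(pi) has norm 1, and joined to
    the vectors of I3 with x + y + z divisible by pi it spans a copy of <1> + M.
    Hence any l in I3 + <1> whose columns x, y, z (after sign changes) satisfy
    this congruence is represented by L ([neighbour]).  Now let l lie in I3, with
    columns in O^2.  Multiplying a column by conj(pi)/pi does not change the Gram
    matrix of l, so each column may be assumed to vanish or to be nonzero modulo
    pi ([strip_pi]).  If one vanishes, l lies in <1,1>, a part of L.  Otherwise
    three nonzero vectors of F_3^2 satisfy a linear relation with two or three
    nonzero coefficients, all +1 or -1 ([F3_relation]).  With three of them the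
    congruence holds for the columns of l; with two, it holds for those two columns
    and the zero column, the third column being kept in the other <1> ([L4_I3]).

    The arithmetic takes place in a copy of O made of pairs of integers, embedded
    in the complex numbers at the end. *)

(** * The ring Z[w] *)

Record quadint := Quad { qre : int; qim : int }.

Definition pair_of_quad x := (qre x, qim x).
Definition quad_of_pair u := Quad u.1 u.2.
Fact pair_of_quadK : cancel pair_of_quad quad_of_pair.
Proof. by case. Qed.
HB.instance Definition _ := Choice.copy quadint (can_type pair_of_quadK).

Implicit Types x y z : quadint.

Lemma quad_eq x y : qre x = qre y -> qim x = qim y -> x = y.
Proof. by case: x y => [p q] [r s] /= -> ->. Qed.

(** The operations are named because they reduce by computation, which turns an
    identity between Gram matrices into identities between integer polynomials;
    the ring structure below has them as its operations. *)
Definition qadd x y := Quad (qre x + qre y) (qim x + qim y).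
Definition qopp x := Quad (- qre x) (- qim x).
Definition qmul x y :=
  Quad (qre x * qre y - 2 * (qim x * qim y)) (qre x * qim y + qim x * qre y).

Local Notation q0 := (Quad 0 0).
Local Notation q1 := (Quad 1 0).

Fact qaddA : associative qadd.
Proof. by move=> x y z; apply: quad_eq => /=; ring. Qed.
Fact qaddC : commutative qadd.
Proof. by move=> x y; apply: quad_eq => /=; ring. Qed.
Fact qadd0 : left_id q0 qadd.
Proof. by move=> x; apply: quad_eq => /=; ring. Qed.
Fact qaddN : left_inverse q0 qopp qadd.
Proof. by move=> x; apply: quad_eq => /=; ring. Qed.
HB.instance Definition _ := GRing.isZmodule.Build quadint qaddA qaddC qadd0 qaddN.

Fact qmulA : associative qmul.
Proof. by move=> x y z; apply: quad_eq => /=; ring. Qed.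
Fact qmulC : commutative qmul.
Proof. by move=> x y; apply: quad_eq => /=; ring. Qed.
Fact qmul1 : left_id q1 qmul.
Proof. by move=> x; apply: quad_eq => /=; ring. Qed.
Fact qmulDl : left_distributive qmul +%R.
Proof. by move=> x y z; apply: quad_eq => /=; ring. Qed.
Fact qone_neq0 : q1 != 0.
Proof. by []. Qed.
HB.instance Definition _ := GRing.Zmodule_isComNzRing.Build quadint
  qmulA qmulC qmul1 qmulDl qone_neq0.

Definition qconj x := Quad (qre x) (- qim x).

Fact qconj_is_zmod_morphism : zmod_morphism qconj.
Proof.
move=> x y; rewrite -[x - y]/(qadd x (qopp y)).
by rewrite -[RHS]/(qadd (qconj x) (qopp (qconj y))); apply: quad_eq => /=; ring.
Qed.
Fact qconj_is_monoid_morphism : monoid_morphism qconj.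
Proof.
split=> [|x y]; first exact: quad_eq.
rewrite -[x * y]/(qmul x y) -[RHS]/(qmul (qconj x) (qconj y)).
by apply: quad_eq => /=; ring.
Qed.
HB.instance Definition _ :=
  GRing.isZmodMorphism.Build quadint quadint qconj qconj_is_zmod_morphism.
HB.instance Definition _ :=
  GRing.isMonoidMorphism.Build quadint quadint qconj qconj_is_monoid_morphism.

Definition qnorm x : int := qre x ^+ 2 + 2 * qim x ^+ 2.

Lemma qnorm_ge0 z : 0 <= qnorm z.
Proof. by rewrite /qnorm; nia. Qed.

Lemma qnorm_eq0 z : qnorm z = 0 -> z = 0.
Proof. by rewrite /qnorm => z0; apply: quad_eq; rewrite /=; nia. Qed.

Definition cross x y := qmul x (qconj y).

Definition scale (e : int) x := qmul (Quad e 0) x.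

Lemma qnorm_scale e x : e ^+ 2 = 1 -> qnorm (scale e x) = qnorm x.
Proof.
move=> eE; transitivity (e ^+ 2 * qnorm x); last by rewrite eE mul1r.
by rewrite /qnorm /=; ring.
Qed.

Lemma cross_scale e x y : e ^+ 2 = 1 -> cross (scale e x) (scale e y) = cross x y.
Proof.
move=> eE; transitivity (scale (e ^+ 2) (cross x y)); first by apply: quad_eq => /=; ring.
by rewrite eE; apply: quad_eq => /=; ring.
Qed.

(** * Representations and Gram matrices *)

Definition conjtr m n (A : 'M[quadint]_(m, n)) := map_mx qconj A^T.

Definition qrepresents m n (L : 'M[quadint]_m) (l : 'M[quadint]_n) :=
  exists X : 'M[quadint]_(n, m), l = X *m L *m conjtr X.

Lemma qrepresents_trans m n k (L : 'M_m) (K : 'M_n) (l : 'M_k) :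
  qrepresents L K -> qrepresents K l -> qrepresents L l.
Proof.
move=> [X ->] [Y ->]; exists (Y *m X).
by rewrite /conjtr trmx_mul map_mxM !mulmxA.
Qed.

Definition seqmx m n (rows : seq (seq quadint)) : 'M[quadint]_(m, n) :=
  \matrix_(i, j) nth 0 (nth [::] rows i) j.

Fixpoint dot (u v : seq quadint) : quadint :=
  match u, v with
  | x :: u', y :: v' => qadd (qmul x y) (dot u' v')
  | _, _ => q0
  end.

Lemma dotE m u v : size u = m -> size v = m -> dot u v = \sum_(k < m) u`_k * v`_k.
Proof.
elim: m u v => [|m IH] [|x u] [|y v] //= => [_ _|[su] [sv]]; first by rewrite big_ord0.
by rewrite big_ord_recl /= (IH _ _ su sv).
Qed.

(** The value of the form with Gram matrix L at coordinate vectors u and v; with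
    lists in place of matrices it computes. *)
Definition sesq (L : seq (seq quadint)) (u v : seq quadint) :=
  dot u [seq dot r (map qconj v) | r <- L].

Definition gram (L X : seq (seq quadint)) := [seq [seq sesq L u v | v <- X] | u <- X].

Lemma gram_mx m n (L X : seq (seq quadint)) :
    size L = m -> all (fun r => size r == m) L ->
    size X = n -> all (fun r => size r == m) X ->
  seqmx n n (gram L X) = seqmx n m X *m seqmx m m L *m conjtr (seqmx n m X).
Proof.
move=> sL /all_nthP aL sX /all_nthP aX.
rewrite -mulmxA; apply/matrixP => i j; rewrite !mxE.
have si: (i < size X)%N by rewrite sX.
have sj: (j < size X)%N by rewrite sX.
rewrite !(nth_map [::]) // /sesq (dotE (m := m)) ?size_map ?sL //; last exact/eqP/aX.
apply: eq_bigr => k _; rewrite !mxE (nth_map [::]) ?sL //; congr (_ * _).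
have sk: (k < size L)%N by rewrite sL.
rewrite (dotE (m := m)) ?size_map; last 2 first; try exact/eqP/aL; try exact/eqP/aX.
apply: eq_bigr => h _; rewrite !mxE (nth_map 0) //.
by rewrite (eqP (aX [::] j sj)).
Qed.

Lemma qrepresents_gram m n (L X l : seq (seq quadint)) :
    size L = m -> all (fun r => size r == m) L ->
    size X = n -> all (fun r => size r == m) X ->
  gram L X = l -> qrepresents (seqmx m m L) (seqmx n n l).
Proof. by move=> sL aL sX aX <-; exists (seqmx n m X); apply: gram_mx. Qed.

(** Proves that one explicit lattice represents another, given the coordinate
    vectors X of a basis of the latter. *)
Ltac gram_ring X :=
  apply: (@qrepresents_gram _ _ _ X) => //;
  cbn -[GRing.add GRing.mul GRing.opp GRing.exp intmul];
  repeat (congr (_ :: _)); apply: quad_eq;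
  cbn -[GRing.add GRing.mul GRing.opp GRing.exp intmul]; try ring.

Definition herm2 (a : int) (b : quadint) (c : int) : 'M[quadint]_2 :=
  seqmx 2 2 [:: [:: Quad a 0; b]; [:: qconj b; Quad c 0]].

(** The Gram matrix of vectors v, w1, w2 with norms a, h1, h2, where b1 and b2 are
    the products of w1 and w2 with v, and k is the product of w1 with w2. *)
Definition herm3 (a h1 h2 : int) (b1 b2 k : quadint) : 'M[quadint]_3 :=
  seqmx 3 3 [:: [:: Quad a 0; qconj b1; qconj b2];
                [:: b1; Quad h1 0; k];
                [:: b2; qconj k; Quad h2 0]].

(** * Positive unimodular ternary lattices *)

Definition I3 := seqmx 3 3 [:: [:: q1; q0; q0]; [:: q0; q1; q0]; [:: q0; q0; q1]].
Definition I1M := seqmx 3 3 [:: [:: q1; q0; q0];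
  [:: q0; Quad 2 0; Quad (-1) 1]; [:: q0; Quad (-1) (-1); Quad 2 0]].

Definition unimod3_repr n (l : 'M[quadint]_n) := qrepresents I3 l \/ qrepresents I1M l.

Lemma unimod3_repr_trans m n (K : 'M_m) (l : 'M_n) :
  qrepresents K l -> unimod3_repr K -> unimod3_repr l.
Proof. by move=> Kl [] IK; [left | right]; apply: qrepresents_trans IK Kl. Qed.

Definition det2 (a : int) b (h : int) := a * h - qnorm b.
(** The lattice orthogonal to the first basis vector v, scaled by the norm a of
    v: with the projections of w1 and w2 as basis, its Gram matrix has diagonal
    entries [det2 a b1 h1] and [det2 a b2 h2] and this off-diagonal entry. *)
Definition proj_form (a : int) b1 b2 k :=
  Quad (a * qre k - qre (qmul b1 (qconj b2))) (a * qim k - qim (qmul b1 (qconj b2))).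
Definition det3 (a h1 h2 : int) b1 b2 k := a * h1 * h2
  + 2 * qre (qmul (qmul (qconj b1) k) b2) - a * qnorm k - h1 * qnorm b2 - h2 * qnorm b1.

Lemma det2_proj (a h1 h2 : int) b1 b2 k :
  det2 a b1 h1 * det2 a b2 h2 - qnorm (proj_form a b1 b2 k) = a * det3 a h1 h2 b1 b2 k.
Proof. rewrite /det2 /det3 /proj_form /qnorm /=; ring. Qed.

(** Reduction uses five changes of basis, written on the Gram entries.  Only one
    direction is stated: the lattice in the new basis represents the old one. *)
Lemma shear10 a h1 h2 b1 b2 k t :
  qrepresents (herm3 a (h1 + 2 * qre (qmul t (qconj b1)) + qnorm t * a) h2
          (qadd b1 (qmul t (Quad a 0))) b2 (qadd k (qmul t (qconj b2))))
        (herm3 a h1 h2 b1 b2 k).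
Proof.
rewrite /herm3 /qnorm.
gram_ring ([:: [:: q1; q0; q0]; [:: qopp t; q1; q0]; [:: q0; q0; q1]]).
Qed.

Lemma shear20 a h1 h2 b1 b2 k t :
  qrepresents (herm3 a h1 (h2 + 2 * qre (qmul t (qconj b2)) + qnorm t * a)
          b1 (qadd b2 (qmul t (Quad a 0))) (qadd k (qmul (qconj t) b1)))
        (herm3 a h1 h2 b1 b2 k).
Proof.
rewrite /herm3 /qnorm.
gram_ring ([:: [:: q1; q0; q0]; [:: q0; q1; q0]; [:: qopp t; q0; q1]]).
Qed.

Lemma swap12 a h1 h2 b1 b2 k :
  qrepresents (herm3 a h2 h1 b2 b1 (qconj k)) (herm3 a h1 h2 b1 b2 k).
Proof.
rewrite /herm3 /qnorm.
gram_ring ([:: [:: q1; q0; q0]; [:: q0; q0; q1]; [:: q0; q1; q0]]).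
Qed.

Lemma swap01 a h1 h2 b1 b2 k :
  qrepresents (herm3 h1 a h2 (qconj b1) (qconj k) (qconj b2)) (herm3 a h1 h2 b1 b2 k).
Proof.
rewrite /herm3 /qnorm.
gram_ring ([:: [:: q0; q1; q0]; [:: q1; q0; q0]; [:: q0; q0; q1]]).
Qed.

Lemma shear21 a h1 h2 b1 b2 k t :
  qrepresents (herm3 a h1 (h2 + 2 * qre (qmul t k) + qnorm t * h1)
          b1 (qadd b2 (qmul t b1)) (qadd k (qmul (qconj t) (Quad h1 0))))
        (herm3 a h1 h2 b1 b2 k).
Proof.
rewrite /herm3 /qnorm.
gram_ring ([:: [:: q1; q0; q0]; [:: q0; q1; q0]; [:: q0; qopp t; q1]]).
Qed.

Lemma exists_reduced_int (a z : int) : 0 < a -> exists t, -a <= 2 * (z + t * a) <= a.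
Proof.
move=> a0; exists (- ((2 * z + a) %/ (2 * a))%Z).
have := divz_eq (2 * z + a) (2 * a).
have : (0 <= (2 * z + a) %% (2 * a))%Z by apply: modz_ge0; lia.
have : ((2 * z + a) %% (2 * a) < 2 * a)%Z by apply: ltz_pmod; lia.
by nia.
Qed.

Definition reduced_mod (a : int) z := (- a <= 2 * qre z <= a) && (- a <= 2 * qim z <= a).

Lemma exists_reduced_mod (a : int) z : 0 < a ->
  exists t, reduced_mod a (qadd z (qmul t (Quad a 0))).
Proof.
move=> a0; have [t Ht] := exists_reduced_int (qre z) a0.
have [u Hu] := exists_reduced_int (qim z) a0.
exists (Quad t u); rewrite /reduced_mod /=; lia.
Qed.

(** Adding multiples of w1 to w2 reduces the projected lattice; adding then
    multiples of v to w1 and w2 reduces their products with v and leaves the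
    projected lattice alone. *)
Lemma herm3_reduce a h1 h2 b1 b2 k : 0 < a -> 0 < det2 a b1 h1 ->
  exists h1' h2' b1' b2' k',
  [/\ qrepresents (herm3 a h1' h2' b1' b2' k') (herm3 a h1 h2 b1 b2 k),
      det2 a b1' h1' = det2 a b1 h1,
      det3 a h1' h2' b1' b2' k' = det3 a h1 h2 b1 b2 k,
      reduced_mod a b1' && reduced_mod a b2' &
      reduced_mod (det2 a b1 h1) (proj_form a b1' b2' k')].
Proof.
move=> a0 m0.
have [t Ht] := exists_reduced_mod (proj_form a b1 b2 k) m0.
have R1 := shear21 a h1 h2 b1 b2 k (qconj t).
have P1 : proj_form a b1 (qadd b2 (qmul (qconj t) b1))
     (qadd k (qmul (qconj (qconj t)) (Quad h1 0)))
   = qadd (proj_form a b1 b2 k) (qmul t (Quad (det2 a b1 h1) 0)).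
  by apply: quad_eq; rewrite /proj_form /det2 /qnorm /=; ring.
rewrite -P1 in Ht.
have D1 : det3 a h1 (h2 + 2 * qre (qmul (qconj t) k) + qnorm (qconj t) * h1)
   b1 (qadd b2 (qmul (qconj t) b1)) (qadd k (qmul (qconj (qconj t)) (Quad h1 0)))
   = det3 a h1 h2 b1 b2 k by rewrite /det3 /qnorm /=; ring.
move: R1 D1 Ht; move: (h2 + _ + _) (qadd b2 _) (qadd k _) => h2' b2' k' R1 D1 Ht {P1}.
have [t1 H1] := exists_reduced_mod b1 a0; have [t2 H2] := exists_reduced_mod b2' a0.
have R2 := shear10 a h1 h2' b1 b2' k' t1.
have P2 : reduced_mod (det2 a b1 h1) (proj_form a (qadd b1 (qmul t1 (Quad a 0))) b2'
                                       (qadd k' (qmul t1 (qconj b2')))).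
  by congr (is_true (reduced_mod _ _)): Ht; apply: quad_eq; rewrite /proj_form /=; ring.
have D2 : det3 a (h1 + 2 * qre (qmul t1 (qconj b1)) + qnorm t1 * a) h2'
   (qadd b1 (qmul t1 (Quad a 0))) b2' (qadd k' (qmul t1 (qconj b2')))
   = det3 a h1 h2 b1 b2 k.
  by rewrite -D1 /det3 /qnorm /=; ring.
have M2 : det2 a (qadd b1 (qmul t1 (Quad a 0)))
    (h1 + 2 * qre (qmul t1 (qconj b1)) + qnorm t1 * a) = det2 a b1 h1.
  by rewrite /det2 /qnorm /=; ring.
move: R2 D2 P2 M2 H1; move: (h1 + _ + _) (qadd b1 _) (qadd k' _).
move=> h1' b1' k'' R2 D2 P2 M2 H1.
exists h1', (h2' + 2 * qre (qmul t2 (qconj b2')) + qnorm t2 * a), b1',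
  (qadd b2' (qmul t2 (Quad a 0))), (qadd k'' (qmul (qconj t2) b1')).
split=> //.
- exact: qrepresents_trans (qrepresents_trans (shear20 a h1' h2' b1' b2' k'' t2) R2) R1.
- by rewrite -D2 /det3 /qnorm /=; ring.
- by rewrite H1.
- by congr (is_true (reduced_mod _ _)): P2; apply: quad_eq; rewrite /proj_form /=; ring.
Qed.

Lemma det3_swap12 a h1 h2 b1 b2 k :
  det3 a h2 h1 b2 b1 (qconj k) = det3 a h1 h2 b1 b2 k.
Proof. by rewrite /det3 /qnorm /=; ring. Qed.
Lemma det3_swap01 a h1 h2 b1 b2 k :
  det3 h1 a h2 (qconj b1) (qconj k) (qconj b2) = det3 a h1 h2 b1 b2 k.
Proof. by rewrite /det3 /qnorm /=; ring. Qed.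

Lemma reduced_sqr (a x : int) : - a <= 2 * x <= a -> 4 * x ^+ 2 <= a ^+ 2.
Proof. by nia. Qed.

Lemma reduced_mod_norm (a : int) z : reduced_mod a z -> 4 * qnorm z <= 3 * a ^+ 2.
Proof.
rewrite /reduced_mod /qnorm => /andP[/reduced_sqr H1 /reduced_sqr H2].
by move: H1 H2; move: (_ ^+ 2) (_ ^+ 2) (_ ^+ 2) => u v w; lia.
Qed.

(** If a is the minimum of a unimodular lattice and m that of the projected one
    scaled by a, of determinant a, then both planes involved have minimum at
    most twice the square root of their determinant. *)
Lemma bound_min (a m : int) : 0 < a -> a ^+ 2 <= 4 * m -> m * m <= 4 * a -> a <= 4.
Proof.
move=> a0 H1 H2; rewrite leNgt; apply/negP => a5.
  have M3 : 5 * a <= 4 * m by nia.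
  have : (5 * a) * (5 * a) <= (4 * m) * (4 * m) by apply: ler_pM; lia.
  by nia.
Qed.

Lemma sqr_norm (x : int) : x ^+ 2 = `|x| ^+ 2.
Proof. by rewrite real_normK // num_real. Qed.

(** Reduction leaves few possibilities for a basis vector next to v when the
    minimum exceeds 1: m is small and its norm h is at least a, so its product
    with v must be long, whereas it is reduced modulo a. *)
Lemma det2_shape (a m h p q : int) :
    1 < a -> a <= 4 -> 0 < m -> m * m <= 4 * a -> a <= h ->
    reduced_mod a (Quad p q) -> m = det2 a (Quad p q) h ->
  (a = 2 /\ m = 1 /\ `|p| = 1 /\ `|q| = 1) \/
  (a = 2 /\ m = 2 /\ p = 0 /\ `|q| = 1) \/
  (a = 4 /\ m = 4 /\ `|p| = 2 /\ `|q| = 2).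
Proof.
move=> a1 a4 m0 m4; rewrite /reduced_mod /det2 /qnorm /=.
have: a = 2 \/ a = 3 \/ a = 4 by clear -a1 a4; lia.
have box : reduced_mod a (Quad p q) ->
    (`|p| = 0 \/ `|p| = 1 \/ `|p| = 2) /\ (`|q| = 0 \/ `|q| = 1 \/ `|q| = 2).
  by rewrite /reduced_mod /=; clear -a4; lia.
rewrite (sqr_norm p) (sqr_norm q).
rewrite /reduced_mod /= in box.
move=> aE ah s; have [pE qE] := box s; move: aE ah s; clear box a1 a4.
set P := `|p| ^+ 2; set Q := `|q| ^+ 2.
have [PE QE] : P = `|p| * `|p| /\ Q = `|q| * `|q| by rewrite /P /Q !expr2.
clearbody P Q.
(* The squares are hidden so that only linear facts remain in each case. *)
by case: pE => [|[]] pE; case: qE => [|[]] qE;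
  rewrite pE in PE; rewrite qE in QE; rewrite {}PE {}QE;
  case=> [|[]] aE ah s mE; rewrite {}aE in ah s mE m4 *; nia.
Qed.

(** A reduced unimodular lattice has minimum 1.  For a = 2 and a = 4,
    [det2_shape] gives the products of w1 and w2 with v up to sign, and the
    projected form follows; then the product of w1 and w2 is not in O. *)
Lemma reduced_min1 a h1 h2 b1 b2 k :
    let m := det2 a b1 h1 in let n := det2 a b2 h2 in
    0 < a -> 0 < m -> det3 a h1 h2 b1 b2 k = 1 ->
    reduced_mod a b1 -> reduced_mod a b2 -> reduced_mod m (proj_form a b1 b2 k) ->
    a <= h1 -> a <= h2 -> m <= n ->
  a = 1.
Proof.
move=> m n a0 m0 D s1 s2 sg ah1 ah2 mn.
have := det2_proj a h1 h2 b1 b2 k; rewrite D -/m -/n mulr1.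
have kE1 : a * qre k = qre (proj_form a b1 b2 k) + qre (qmul b1 (qconj b2)).
  by rewrite /=; ring.
have kE2 : a * qim k = qim (proj_form a b1 b2 k) + qim (qmul b1 (qconj b2)).
  by rewrite /=; ring.
have mE : m = det2 a b1 h1 by [].
have nE : n = det2 a b2 h2 by [].
clear D; clearbody m n; move: sg kE1 kE2; move: (proj_form _ _ _ _) => g sg kE1 kE2 E.
have [a4 m4] : a <= 4 /\ m * m <= 4 * a.
  have H1 := reduced_mod_norm s1; have H2 := reduced_mod_norm sg.
  have M1 : a * a <= a * h1 by rewrite ler_pM2l.
  have M2 : m * m <= m * n by rewrite ler_pM2l.
  rewrite !expr2 in H1 H2; rewrite /det2 in mE.
  have M3 : m * m <= 4 * a by clear -M2 H2 E; lia.
  by split=> //; apply: bound_min M3 => //; rewrite expr2; clear -M1 H1 mE; lia.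
case: (eqVneq a 1) => // a1; exfalso.
have {}a1 : 1 < a by clear -a0 a1; lia.
case: b1 b2 k g s1 s2 mE nE kE1 kE2 sg E => [p1 q1] [p2 q2] [k1 k2] [g1 g2].
move=> s1 s2 mE nE /=; rewrite /reduced_mod /qnorm /= => kE1 kE2 sg E.
have S1 := det2_shape a1 a4 m0 m4 ah1 s1 mE.
have S2 : n * n <= 4 * a -> (a = 2 /\ n = 1 /\ `|p2| = 1 /\ `|q2| = 1) \/
  (a = 2 /\ n = 2 /\ p2 = 0 /\ `|q2| = 1) \/
  (a = 4 /\ n = 4 /\ `|p2| = 2 /\ `|q2| = 2).
  by move=> n4; apply: det2_shape nE => //; clear -m0 mn; lia.
clear mE nE s1 s2 ah1 ah2 h1 h2 a1 a4 m0 m4 a0.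
move: E kE1 kE2; case: S1 => [|[]] [aE [mE [p1E q1E]]];
  rewrite {}aE {}mE in sg S2 mn * => E.
- (* a = 2, m = 1: then twice the product of w1 and w2 would be w(1 + w) up to
     conjugation and sign, which 2 does not divide. *)
  have [g1E g2E] : g1 = 0 /\ g2 = 0 by clear -sg; lia.
  rewrite {}g1E {}g2E in sg E * => _.
  have n2 : n = 2 by clear -E; lia.
  rewrite n2 in S2; have {S2} [-> q2E] : p2 = 0 /\ `|q2| = 1 by clear -S2; lia.
  by clear -p1E q2E; lia.
- (* a = 2, m = 2: the projected form has off-diagonal entry +w or -w, and
     b1 conj(b2) is +2 or -2. *)
  have gE : (g1 = 0 \/ `|g1| = 1) /\ (g2 = 0 \/ `|g2| = 1) by clear -sg; lia.
  rewrite (sqr_norm g1) (sqr_norm g2) in E.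
  rewrite {}p1E.
  case: gE => -[g1E|g1E] [g2E|g2E]; rewrite ?{1}g1E ?{1}g2E ?normr0 in E;
    try by clear -E mn; lia.
  have n2 : n = 2 by clear -E; lia.
  rewrite n2 in S2; have {S2} [-> q2E] : p2 = 0 /\ `|q2| = 1 by clear -S2; lia.
  by clear -g2E; lia.
- (* a = 4, m = 4: g, b1 and b2 all have coordinates +2 or -2, so b1 conj(b2) is
     divisible by 4 and g is not. *)
  have gE : (`|g1| = 0 \/ `|g1| = 1 \/ `|g1| = 2) /\ (`|g2| = 0 \/ `|g2| = 1 \/ `|g2| = 2).
    by clear -sg; lia.
  rewrite (sqr_norm g1) (sqr_norm g2) in E.
  case: gE => -[|[]] g1E [|[]] g2E; rewrite g1E g2E in E; try by clear -E mn; lia.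
  have n2 : n = 4 by clear -E; lia.
  rewrite n2 in S2; have {S2} [p2E q2E] : `|p2| = 2 /\ `|q2| = 2 by clear -S2; lia.
  clear -p1E q1E p2E q2E g1E.
  have [] : g1 = 2 \/ g1 = -2 by clear -g1E; lia.
  all: have [] : p1 = 2 \/ p1 = -2 by clear -p1E; lia.
  all: have [] : q1 = 2 \/ q1 = -2 by clear -q1E; lia.
  all: by move=> -> -> ->; clear -p2E q2E; lia.
Qed.

Lemma unimod3_repr_even k1 k2 : `|k1| = 1 -> `|k2| = 1 ->
  unimod3_repr (herm3 1 2 2 q0 q0 (Quad k1 k2)).
Proof.
move=> k1E k2E; right; rewrite /herm3.
have [] : k1 = 1 \/ k1 = -1 by lia.
all: have [] : k2 = 1 \/ k2 = -1 by lia.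
all: move=> -> ->.
- gram_ring ([:: [:: q1; q0; q0]; [:: q0; q1; q0]; [:: q0; q1; q1]]).
- gram_ring ([:: [:: q1; q0; q0]; [:: q0; Quad (-1) 0; q0]; [:: q0; q0; q1]]).
- gram_ring ([:: [:: q1; q0; q0]; [:: q0; q1; q0]; [:: q0; q0; q1]]).
- gram_ring ([:: [:: q1; q0; q0]; [:: q0; Quad (-1) 0; q0]; [:: q0; q1; q1]]).
Qed.

Lemma reduced_mod1 z : reduced_mod 1 z -> z = q0.
Proof. by case: z => p q; rewrite /reduced_mod /= => s; congr Quad; lia. Qed.

Lemma det2_gt0 a h b : 0 < a -> 0 < det2 a b h -> 0 < h.
Proof.
move=> a0 m0; have : 0 <= qnorm b by rewrite /qnorm; nia.
by move=> b0; rewrite -(pmulr_rgt0 _ a0); rewrite /det2 in m0; lia.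
Qed.

(** In a lattice <1> + P with P unimodular and reduced, P has minimum 1 or 2: it
    is <1,1> or, up to signs and a shear, M. *)
Lemma unimod3_repr_split h1 h2 k :
    reduced_mod h1 k -> det3 1 h1 h2 q0 q0 k = 1 -> 0 < h1 -> h1 <= h2 ->
  unimod3_repr (herm3 1 h1 h2 q0 q0 k).
Proof.
case: k => k1 k2 sk D h1_gt0 h12.
have {D} D : h1 * h2 - (k1 ^+ 2 + 2 * k2 ^+ 2) = 1 by rewrite -[RHS]D /det3 /qnorm /=; ring.
have h1_le2 : h1 <= 2.
  have := reduced_mod_norm sk; have : h1 * h1 <= h1 * h2 by rewrite ler_pM2l.
  by rewrite /qnorm /= expr2 => ? ?; nia.
have : h1 = 1 \/ h1 = 2 by lia.
rewrite /reduced_mod /= in sk; clear h1_le2 h1_gt0.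
case=> h1E; rewrite h1E in sk D h12 *.
  have [k1E k2E] : k1 = 0 /\ k2 = 0 by lia.
  rewrite k1E k2E in D *; have -> : h2 = 1 by lia.
  left; exists 1%:M; rewrite mul1mx /herm3 /conjtr trmx1 map_mx1 mulmx1.
  by congr (seqmx _ _ _); rewrite /qconj oppr0.
have [k1E k2E] : (`|k1| = 0 \/ `|k1| = 1) /\ (`|k2| = 0 \/ `|k2| = 1) by lia.
rewrite (sqr_norm k1) (sqr_norm k2) in D.
case: k1E k2E => [] k1E [] k2E; rewrite k1E k2E in D; try by lia.
have -> : h2 = 2 by lia.
exact: unimod3_repr_even.
Qed.

(** Induction on the norm of the first basis vector, then on the first entry of
    the projected lattice: a reduced basis that is not yet minimal gets its vectors
    exchanged, and a minimal one has a = 1, so that v splits off. *)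
Theorem unimodular3_class a h1 h2 b1 b2 k :
  0 < a -> 0 < det2 a b1 h1 -> det3 a h1 h2 b1 b2 k = 1 ->
  unimod3_repr (herm3 a h1 h2 b1 b2 k).
Proof.
have [i] := ubnP `|a|%N; elim: i => // i IHa in a h1 h2 b1 b2 k *.
have [j] := ubnP `|det2 a b1 h1|%N; elim: j => // j IHm in h1 h2 b1 b2 k *.
move=> mj ai a0 m0 D.
have [h1' [h2' [b1' [b2' [k' [R M D' /andP[s1 s2] sg]]]]]] := herm3_reduce h2 b2 k a0 m0.
apply: unimod3_repr_trans R _; rewrite D in D'; rewrite -M in mj m0 sg.
move: h1' h2' b1' b2' k' {M} mj m0 D' s1 s2 sg.
move=> {h1 h2 b1 b2 k D} h1 h2 b1 b2 k mj m0 D s1 s2 sg.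
have E := det2_proj a h1 h2 b1 b2 k.
have n0 : 0 < det2 a b2 h2.
  rewrite D mulr1 in E; have : 0 <= qnorm (proj_form a b1 b2 k) by rewrite /qnorm; nia.
  by move=> ?; rewrite -(pmulr_rgt0 _ m0); lia.
have h1_gt0 := det2_gt0 a0 m0; have h2_gt0 := det2_gt0 a0 n0.
have [ah1|h1a] := leP a h1; last first.
  apply: unimod3_repr_trans (swap01 a h1 h2 b1 b2 k) _; apply: IHa.
  - by clear -ai h1a h1_gt0; lia.
  - exact: h1_gt0.
  - by rewrite /det2 /qnorm /= in m0 *; lia.
  - by rewrite det3_swap01.
have [ah2|h2a] := leP a h2; last first.
  apply: unimod3_repr_trans (swap12 a h1 h2 b1 b2 k) _.
  apply: unimod3_repr_trans (swap01 a h2 h1 b2 b1 (qconj k)) _; apply: IHa.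
  - by clear -ai h2a h2_gt0; lia.
  - exact: h2_gt0.
  - by rewrite /det2 /qnorm /= in n0 *; lia.
  - by rewrite det3_swap01 det3_swap12.
have [mn|nm] := leP (det2 a b1 h1) (det2 a b2 h2); last first.
  apply: unimod3_repr_trans (swap12 a h1 h2 b1 b2 k) _; apply: IHm => //.
  - by lia.
  - by rewrite det3_swap12.
have a1 := reduced_min1 a0 m0 D s1 s2 sg ah1 ah2 mn.
rewrite a1 in s1 s2 sg mn D *.
move: sg mn D; rewrite (reduced_mod1 s1) (reduced_mod1 s2).
have -> : det2 1 q0 h1 = h1 by rewrite /det2 /qnorm /=; ring.
have -> : det2 1 q0 h2 = h2 by rewrite /det2 /qnorm /=; ring.
have -> : proj_form 1 q0 q0 k = k by apply: quad_eq; rewrite /=; ring.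
by move=> sg mn D; apply: unimod3_repr_split.
Qed.

(** * Integral overlattices of binary lattices *)

(** The values x^2 and n - 2y^2, for x and y between 0 and p/2, are p + 1 elements
    of F_p, so two of them agree; they come from different families because
    squares are distinct in this range. *)
Lemma qnorm_onto_Fp (p : nat) (n : int) : prime p -> odd p ->
  exists z, (p %| qnorm z - n)%Z.
Proof.
move=> p_pr p_odd.
have chp := pchar_Fp p_pr.
pose k := p./2.+1.
pose f (u : 'I_k + 'I_k) : 'F_p :=
  match u with inl i => i%:R ^+ 2 | inr j => n%:~R - 2 * j%:R ^+ 2 end.
have sq_inj (i j : 'I_k) : i%:R ^+ 2 = j%:R ^+ 2 :> 'F_p -> i = j.
  wlog le_ji : i j / (j <= i)%N => [IH|].
    by case/orP: (leq_total j i) => le_ij => [/IH|/esym/IH/esym]; apply.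
  move=> /eqP; rewrite eqf_sqr -subr_eq0 -natrB // -[_ == - _]subr_eq0 opprK -natrD.
  have small_dvd m : (m < p)%N -> (p %| m)%N -> m = 0%N.
    by case: m => // m mp /dvdn_leq => /(_ isT); rewrite leqNgt mp.
  have [lt_sub lt_add] : (i - j < p)%N /\ (i + j < p)%N.
    have := odd_double_half p; rewrite p_odd add1n.
    have [Hi Hj] := (ltn_ord i, ltn_ord j); rewrite /k in Hi Hj; move: Hi Hj.
    by move: (p./2) (i : nat) (j : nat) => h u v Hu Hv pE; clear -Hu Hv pE; split; lia.
  rewrite -!(dvdn_pcharf chp) => /orP[] /small_dvd E; apply: val_inj => /=.
    by apply/eqP; rewrite eqn_leq le_ji andbT -subn_eq0 E.
  by move/eqP: (E lt_add); rewrite addn_eq0 => /andP[/eqP-> /eqP->].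
have : ~~ injectiveb f.
  apply/negP => /injectiveP /leq_card; rewrite card_sum card_ord card_Fp //.
  by have := odd_double_half p; rewrite p_odd /k; lia.
have p2 : 2 != 0 :> 'F_p.
  rewrite -(dvdn_pcharf chp); apply/negP => /dvdn_leq => /(_ isT).
  by have := prime_gt1 p_pr; case: (p) p_odd => [|[|[|]]].
have sol (i j : 'I_k) : i%:R ^+ 2 = n%:~R - 2 * j%:R ^+ 2 :> 'F_p ->
    exists z, (p %| qnorm z - n)%Z.
  move=> E; exists (Quad i%:Z j%:Z); rewrite (dvdz_pcharf chp) /qnorm /=.
  have -> : (i%:Z ^+ 2 + 2 * j%:Z ^+ 2 - n)%:~R
              = i%:R ^+ 2 - (n%:~R - 2 * j%:R ^+ 2) :> 'F_p by ring.
  by rewrite E subrr.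
case/injectivePn => -[] i [[] j] // ij /=.
- by move=> /sq_inj E; rewrite E eqxx in ij.
- exact: sol.
- by move=> /esym; apply: sol.
- move=> /addrI /oppr_inj /(mulfI p2) /sq_inj E; by rewrite E eqxx in ij.
Qed.

(** The inclusion into the overlattice is strict, as the discriminant drops. *)
Definition has_overlattice a b c := exists a' b' c',
  [/\ qrepresents (herm2 a' b' c') (herm2 a b c), 0 < a', 0 < det2 a' b' c' &
      det2 a' b' c' < det2 a b c].

Lemma has_overlattice_trans a b c a' b' c' :
    qrepresents (herm2 a' b' c') (herm2 a b c) -> det2 a b c = det2 a' b' c' ->
  has_overlattice a' b' c' -> has_overlattice a b c.
Proof.
move=> R M [a2 [b2 [c2 [R2 a0 m0 lt]]]]; exists a2, b2, c2.
by split=> //; [apply: qrepresents_trans R2 R | rewrite M].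
Qed.

Lemma swap_repr2 a b c : qrepresents (herm2 c (qconj b) a) (herm2 a b c).
Proof.
rewrite /herm2.
gram_ring ([:: [:: q0; q1]; [:: q1; q0]]).
Qed.

Lemma det2_swap a b c : det2 c (qconj b) a = det2 a b c.
Proof. by rewrite /det2 /qnorm /=; ring. Qed.

Lemma has_overlattice_swap a b c : has_overlattice c (qconj b) a -> has_overlattice a b c.
Proof. by apply: has_overlattice_trans; [apply: swap_repr2 | rewrite det2_swap]. Qed.

(** Adjoins the vector (s e0 + e1)/mu to the lattice with basis e0, e1.  The
    coefficient 1 of e1 makes e0 and the new vector a basis. *)
Lemma overlattice_adjoin a b c s mu b' c' :
    0 < a -> 0 < det2 a b c -> 1 < qnorm mu ->
    qadd (qmul (Quad a 0) (qconj s)) b = qmul (qconj mu) b' ->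
    a * qnorm s + 2 * qre (qmul s b) + c = qnorm mu * c' ->
  has_overlattice a b c.
Proof.
move=> a0 m0 mu1 bE cE; exists a, b', c'.
have {}bE : b = qadd (qmul (qconj mu) b') (qopp (qmul (Quad a 0) (qconj s))).
  by rewrite -bE; apply: quad_eq => /=; ring.
have {}cE : c = qnorm mu * c' - a * qnorm s - 2 * qre (qmul s b).
  by rewrite -cE; ring.
have mE : det2 a b c = qnorm mu * det2 a b' c'.
  by rewrite cE bE /det2 /qnorm /=; ring.
have m'0 : 0 < det2 a b' c' by rewrite mE pmulr_rgt0 // in m0; lia.
split=> //; last by rewrite mE -subr_gt0 -{2}[det2 _ _ _]mul1r -mulrBl mulr_gt0 // subr_gt0.
rewrite cE bE /qnorm /herm2.
gram_ring ([:: [:: q1; q0]; [:: qopp s; mu]]).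
Qed.

Lemma Euclid_dvdzM (p : nat) (x y : int) : prime p ->
  (p %| x * y)%Z = (p %| x)%Z || (p %| y)%Z.
Proof. by move=> p_pr; rewrite !dvdzE abszM Euclid_dvdM. Qed.

(** If the discriminant is even, the form is degenerate modulo the prime w of norm
    2; a vector r in the radical has even norm, so r/w can be adjoined.  The
    radical contains e1, e0 or e0 + e1. *)
Lemma overlattice_even a b c : 0 < a -> 0 < c -> 0 < det2 a b c -> (2 %| det2 a b c)%Z ->
  has_overlattice a b c.
Proof.
move=> a0 c0 m0 d2.
have rad_e1 a' b' c' : 0 < a' -> 0 < det2 a' b' c' ->
    (2 %| qre b')%Z -> (2 %| c')%Z -> has_overlattice a' b' c'.
  case: b' => b0 b1 a'0 m'0 /= /dvdzP[x xE] /dvdzP[y yE].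
  apply: (@overlattice_adjoin a' _ c' q0 (Quad 0 1) (Quad (- b1) x) y) => //.
    by apply: quad_eq => /=; lia.
  by rewrite /qnorm /=; lia.
have acE : a * c = det2 a b c + 2 * qim b ^+ 2 + qre b * qre b.
  by rewrite /det2 /qnorm; ring.
have ac2 : (2 %| a)%Z || (2 %| c)%Z = (2 %| qre b)%Z.
  have d2' : (2 %| det2 a b c + 2 * qim b ^+ 2)%Z by rewrite rpredD // dvdz_mulr.
  by rewrite -(Euclid_dvdzM a c (isT : prime 2)) acE (rpredDl _ d2') [LHS]Euclid_dvdzM ?orbb.
have [b0|b0] := boolP (2 %| qre b)%Z.
  move: ac2; rewrite b0.
  case/orP => [a2|c2]; last exact: rad_e1.
  by apply: has_overlattice_swap; apply: rad_e1; rewrite ?det2_swap.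
have /norP[a1 c1] : ~~ ((2 %| a)%Z || (2 %| c)%Z) by rewrite ac2.
clear ac2 acE rad_e1.
case: b b0 m0 d2 => b0 b1 /= b0E m0 d2.
apply: (@overlattice_adjoin a _ c q1 (Quad 0 1) (Quad (- b1) ((a + b0) %/ 2)%Z)
          ((a + 2 * b0 + c) %/ 2)%Z) => //.
  by apply: quad_eq => /=; lia.
by rewrite /qnorm /=; lia.
Qed.

Lemma inverse_mod (m a : int) : coprimez m a -> exists u, (m %| a * u - 1)%Z.
Proof.
case/coprimezP => -[u v] /= E; exists v; apply/dvdzP; exists (- u); lia.
Qed.

Lemma coprime_prime (p : nat) (a : int) : prime p -> ~~ (p %| a)%Z -> coprimez p%:Z a.
Proof. by move=> p_pr; rewrite coprimezE /= prime_coprime // dvdzE. Qed.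

Lemma qnorm_prime_gt1 (p : nat) : prime p -> 1 < qnorm (Quad p 0).
Proof. by move=> p_pr; rewrite /qnorm /=; have := prime_gt1 p_pr; nia. Qed.

(** The vector orthogonal to e0 modulo p^2 has norm det/a modulo p^2, that is 0,
    so its quotient by p can be adjoined. *)
Lemma overlattice_square_unit (p : nat) a b c : prime p -> 0 < a -> 0 < det2 a b c ->
  ~~ (p %| a)%Z -> (p%:Z ^+ 2 %| det2 a b c)%Z -> has_overlattice a b c.
Proof.
move=> p_pr a0 m0 pa pd.
have p2a : coprimez (p%:Z ^+ 2) a by rewrite coprimezXl ?coprime_prime.
have [u uE] := inverse_mod p2a.
have [q qE] := dvdzP uE.
pose s := qmul (Quad (- u) 0) (qconj b).
have : (p%:Z ^+ 2 %| a * qnorm s + 2 * qre (qmul s b) + c)%Z.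
  rewrite -(Gauss_dvdzr _ p2a).
  have -> : a * (a * qnorm s + 2 * qre (qmul s b) + c)
            = det2 a b c + (a * u - 1) ^+ 2 * qnorm b.
    by rewrite /det2 /s /qnorm /=; ring.
  by rewrite rpredD // dvdz_mulr // dvdz_mulr.
case/dvdzP => c' c'E.
apply: (@overlattice_adjoin a b c s (Quad p 0) (qmul (Quad (- q * p) 0) b) c')
         (qnorm_prime_gt1 p_pr) _ _ => //.
  have auE : a * u = q * p%:Z ^+ 2 + 1 by rewrite -qE; ring.
  apply: quad_eq => /=.
    transitivity (- (a * u) * qre b + qre b); first by ring.
    by rewrite auE; ring.
  transitivity (- (a * u) * qim b + qim b); first by ring.
  by rewrite auE; ring.
by rewrite c'E /qnorm /=; ring.
Qed.

Lemma overlattice_div_e1 (p : nat) a b c : prime p -> 0 < a -> 0 < det2 a b c ->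
    (p %| qre b)%Z -> (p %| qim b)%Z -> (p%:Z ^+ 2 %| c)%Z -> has_overlattice a b c.
Proof.
move=> p_pr a0 m0 /dvdzP[x xE] /dvdzP[y yE] /dvdzP[z zE].
apply: (@overlattice_adjoin a b c q0 (Quad p 0) (Quad x y) z) (qnorm_prime_gt1 p_pr) _ _ => //.
  by apply: quad_eq => /=; rewrite ?xE ?yE; ring.
by rewrite zE /qnorm /=; ring.
Qed.

(** If the form is p times another form, that one has an isotropic vector modulo
    p, because the norm represents everything modulo p; its quotient by p can be
    adjoined. *)
Lemma overlattice_content (p : nat) a b c : prime p -> odd p ->
    0 < a -> 0 < c -> 0 < det2 a b c ->
  (p %| a)%Z -> (p %| qre b)%Z -> (p %| qim b)%Z -> (p %| c)%Z -> has_overlattice a b c.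
Proof.
move=> p_pr p_odd a0 c0 m0 /dvdzP[a1 aE] pb0 pb1 /dvdzP[c1 cE].
have p0 : p%:Z != 0 by have := prime_gt0 p_pr; lia.
have [pa|pa] := boolP (p %| a1)%Z.
  apply: has_overlattice_swap; apply: (overlattice_div_e1 p_pr); rewrite ?det2_swap //=.
    by rewrite rpredN.
  by rewrite aE expr2 dvdz_mul.
have [/dvdzP[x xE] /dvdzP[y yE]] := (pb0, pb1).
pose b1 := Quad x y.
have [u uE] := inverse_mod (coprime_prime p_pr pa).
have [z zE] := qnorm_onto_Fp (qnorm b1 - a1 * c1) p_pr p_odd.
(* s solves a1 s + conj(b1) = z modulo p; the norm of s e0 + e1 is then, up to
   the factor a1, the norm of z plus the determinant. *)
pose s := qmul (Quad u 0) (qadd z (qopp (qconj b1))).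
have : (p %| a1 * qnorm s + 2 * qre (qmul s b1) + c1)%Z.
  rewrite -(Gauss_dvdzr _ (coprime_prime p_pr pa)).
  have -> : a1 * (a1 * qnorm s + 2 * qre (qmul s b1) + c1)
     = (qnorm z - (qnorm b1 - a1 * c1)) + (a1 * u - 1) *
     ((a1 * u + 1) * (qnorm (qadd z (qopp (qconj b1))))
       + 2 * qre (qmul b1 (qadd z (qopp (qconj b1))))).
    by rewrite /s /qnorm /=; ring.
  by rewrite rpredD // dvdz_mulr.
case/dvdzP => c' c'E.
apply: (@overlattice_adjoin a b c s (Quad p 0) (qadd (qmul (Quad a1 0) (qconj s)) b1) c')
         (qnorm_prime_gt1 p_pr) _ _ => //.
  by apply: quad_eq; rewrite /b1 /= ?xE ?yE aE; ring.
transitivity (p%:Z * (a1 * qnorm s + 2 * qre (qmul s b1) + c1)); last first.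
  by rewrite c'E /qnorm /=; ring.
by rewrite /b1 /qnorm /= aE cE xE yE; ring.
Qed.

Lemma shear_repr2 a b c t :
  qrepresents (herm2 (a + 2 * qre (qmul t (qconj b)) + c * qnorm t)
                     (qadd b (qmul t (Quad c 0))) c)
              (herm2 a b c).
Proof.
rewrite /herm2 /qnorm.
gram_ring ([:: [:: q1; qopp t]; [:: q0; q1]]).
Qed.

Lemma prime_odd_ndvd2 (p : nat) : prime p -> odd p -> ~~ (p %| 2)%Z.
Proof.
by move=> p_pr p_odd; rewrite dvdzE /= dvdn_prime2 //; apply: contraTneq p_odd => ->.
Qed.

Lemma dvdz_double (p : nat) (x : int) : prime p -> odd p ->
  (p %| 2 * x)%Z = (p %| x)%Z.
Proof.
by move=> p_pr p_odd; rewrite Euclid_dvdzM // (negPf (prime_odd_ndvd2 p_pr p_odd)).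
Qed.

Definition content_dvd (p : nat) a b c :=
  [&& (p %| a)%Z, (p %| qre b)%Z, (p %| qim b)%Z & (p %| c)%Z].

(** Reduces to the case where a is prime to p: a nonzero form modulo an odd p takes
    a nonzero value at e0, e1, e0 + e1 or e0 + w e1.  A form that vanishes modulo
    p falls under [overlattice_content]. *)
Lemma overlattice_square (p : nat) a b c : prime p -> odd p ->
    0 < a -> 0 < det2 a b c ->
  (p%:Z ^+ 2 %| det2 a b c)%Z -> has_overlattice a b c.
Proof.
move=> p_pr p_odd a0 m0 pd; have c0 := det2_gt0 a0 m0.
have [pa|pa] := boolP (p %| a)%Z; last exact: (overlattice_square_unit p_pr).
have [pc|pc] := boolP (p %| c)%Z; last first.
  by apply: has_overlattice_swap; apply: (overlattice_square_unit p_pr); rewrite ?det2_swap.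
have shear t : ~~ (p %| 2 * qre (qmul t (qconj b)))%Z -> has_overlattice a b c.
  move=> pt; have mE : det2 a b c
      = det2 (a + 2 * qre (qmul t (qconj b)) + c * qnorm t) (qadd b (qmul t (Quad c 0))) c.
    by rewrite /det2 /qnorm /=; ring.
  apply: (has_overlattice_trans (shear_repr2 a b c t) mE).
  rewrite mE in m0 pd; apply: (overlattice_square_unit p_pr _ m0 _ pd).
    by apply: (@det2_gt0 c _ (qconj (qadd b (qmul t (Quad c 0))))); rewrite // det2_swap.
  apply: contra pt => pt; rewrite -[X in (_ %| X)%Z](addrK a) [_ + a]addrC.
  rewrite -[X in (_ %| X - _)%Z](addrK (c * qnorm t)).
  by rewrite rpredB // rpredB // dvdz_mulr.
have [pb0|pb0] := boolP (p %| qre b)%Z; last first.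
  apply: (shear q1); rewrite /= dvdz_double //.
  by have -> : 1 * qre b - 2 * (0 * - qim b) = qre b by ring.
have [pb1|pb1] := boolP (p %| qim b)%Z; last first.
  apply: (shear (Quad 0 1)); rewrite /= dvdz_double //.
  by have -> : 0 * qre b - 2 * (1 * - qim b) = 2 * qim b; [ring | rewrite dvdz_double].
exact: (overlattice_content p_pr p_odd).
Qed.

(** * Embedding a maximal binary lattice in a unimodular ternary one *)

(** The adjugate of the binary form: bordering [herm2 a b c] by the column (s, t)
    and the corner e gives determinant e * det2 a b c - adj_form a b c s t. *)
Definition adj_form a b c s t := a * qnorm t + c * qnorm s - 2 * qre (qmul b (qmul t s)).

(** If a is prime to p, a multiple of a norm already gives -1, and so for c; if
    a = c = 0 modulo p the adjugate form is linear in t for s = 1. *)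
Lemma adj_form_local (p : nat) a b c : prime p -> odd p -> ~~ content_dvd p a b c ->
  exists s t, (p %| adj_form a b c s t + 1)%Z.
Proof.
move=> p_pr p_odd; rewrite /content_dvd /adj_form.
have [pa|pa] /= := boolP (p %| a)%Z; last first.
  have [u uE] := inverse_mod (coprime_prime p_pr pa).
  have [z zE] := qnorm_onto_Fp (- u) p_pr p_odd.
  exists q0, z.
  have -> : a * qnorm z + c * qnorm q0 - 2 * qre (qmul b (qmul z q0)) + 1
     = a * (qnorm z - - u) - (a * u - 1) by rewrite /qnorm /=; ring.
  by rewrite rpredB // dvdz_mull.
have [pc|pc] /= := boolP (p %| c)%Z; last first.
  have [u uE] := inverse_mod (coprime_prime p_pr pc).
  have [z zE] := qnorm_onto_Fp (- u) p_pr p_odd.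
  exists z, q0.
  have -> : a * qnorm q0 + c * qnorm z - 2 * qre (qmul b (qmul q0 z)) + 1
     = c * (qnorm z - - u) - (c * u - 1) by rewrite /qnorm /=; ring.
  by rewrite rpredB // dvdz_mull.
rewrite andbT negb_and => /orP[] pb.
  have [|u uE] := @inverse_mod p (2 * qre b); first by rewrite coprime_prime // dvdz_double.
  exists q1, (Quad u 0).
  have -> : a * qnorm (Quad u 0) + c * qnorm q1 - 2 * qre (qmul b (qmul (Quad u 0) q1)) + 1
     = a * u ^+ 2 + c - (2 * qre b * u - 1) by rewrite /qnorm /=; ring.
  by rewrite rpredB // rpredD // dvdz_mulr.
have [|u uE] := @inverse_mod p (2 * (2 * qim b)).
  by rewrite coprime_prime // !dvdz_double.
exists q1, (Quad 0 (- u)).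
have -> : a * qnorm (Quad 0 (- u)) + c * qnorm q1 - 2 * qre (qmul b (qmul (Quad 0 (- u)) q1))
          + 1 = 2 * a * u ^+ 2 + c - (2 * (2 * qim b) * u - 1) by rewrite /qnorm /=; ring.
by rewrite rpredB // rpredD // -mulrA dvdz_mull // dvdz_mulr.
Qed.

Lemma adj_form_cong a b c s t (m : int) w v :
  (m %| adj_form a b c (qadd s (qmul (Quad m 0) w)) (qadd t (qmul (Quad m 0) v))
        - adj_form a b c s t)%Z.
Proof.
apply/dvdzP; exists (a * (2 * qre (qmul t (qconj v)) + m * qnorm v)
  + c * (2 * qre (qmul s (qconj w)) + m * qnorm w)
  - 2 * qre (qmul b (qadd (qadd (qmul t w) (qmul v s)) (qmul (Quad m 0) (qmul v w))))).
rewrite /adj_form /qnorm /=; ring.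
Qed.

Lemma adj_form_chinese a b c (m n : int) : coprimez m n ->
    (exists s t, (m %| adj_form a b c s t + 1)%Z) ->
    (exists s t, (n %| adj_form a b c s t + 1)%Z) ->
  exists s t, (m * n %| adj_form a b c s t + 1)%Z.
Proof.
move=> co [s1 [t1 E1]] [s2 [t2 E2]]; have /coprimezP[[x y] /= xyE] := co.
pose mix u v := qadd u (qmul (Quad m 0) (qmul (Quad x 0) (qadd v (qopp u)))).
have mixE u v : mix u v = qadd v (qmul (Quad n 0) (qmul (Quad y 0) (qadd u (qopp v)))).
  have yn : y * n = 1 - x * m by rewrite -xyE; ring.
  apply: quad_eq; rewrite /mix /=.
    transitivity ((x * m) * qre v + (1 - x * m) * qre u); first by ring.
    transitivity ((y * n) * qre u + (1 - y * n) * qre v); last by ring.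
    by rewrite yn; ring.
  transitivity ((x * m) * qim v + (1 - x * m) * qim u); first by ring.
  transitivity ((y * n) * qim u + (1 - y * n) * qim v); last by ring.
  by rewrite yn; ring.
exists (mix s1 s2), (mix t1 t2); rewrite Gauss_dvdz //; apply/andP; split.
  rewrite -(subrK (adj_form a b c s1 t1) (adj_form _ _ _ (mix _ _) _)) -addrA.
  by rewrite rpredD // adj_form_cong.
rewrite !mixE -(subrK (adj_form a b c s2 t2) (adj_form _ _ _ (qadd _ _) _)) -addrA.
by rewrite rpredD // adj_form_cong.
Qed.

Lemma adj_form_solution a b c (n : nat) : (0 < n)%N ->
    (forall p, prime p -> (p %| n)%N -> ~~ (p ^ 2 %| n)%N /\
       exists s t, (p %| adj_form a b c s t + 1)%Z) ->
  exists s t, (n %| adj_form a b c s t + 1)%Z.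
Proof.
elim/ltn_ind: n => n IH n0 Hp.
have [n1|n1] := leqP n 1.
  by exists 0, 0; have -> : n = 1%N by lia.
have p_pr := pdiv_prime n1; have pn := pdiv_dvd n; set p := pdiv n in p_pr pn.
have [p2 Hsol] := Hp p p_pr pn.
have [q nE] := dvdnP pn.
have q_gt0 : (0 < q)%N by rewrite nE muln_gt0 in n0; case/andP: n0.
have pq : ~~ (p %| q)%N.
  by apply: contra p2 => /dvdnP[r rE]; rewrite nE rE -mulnA mulnn dvdn_mull.
rewrite nE PoszM; apply: adj_form_chinese => //.
  by rewrite coprimezE /= coprime_sym prime_coprime.
apply: IH => //; first by rewrite nE ltn_Pmulr // prime_gt1.
move=> r r_pr rq; have rn : (r %| n)%N by rewrite nE dvdn_mulr.
have [r2 ?] := Hp r r_pr rn; split=> //.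
by apply: contra r2 => /dvdn_mulr H; rewrite nE H.
Qed.

Lemma extend_repr a b c e s t : qrepresents (herm3 a c e (qconj b) s t) (herm2 a b c).
Proof.
rewrite /herm3 /herm2.
gram_ring ([:: [:: q1; q0; q0]; [:: q0; q1; q0]]).
Qed.

(** Induction on the discriminant: a lattice with no proper overlattice of the
    kinds above is bordered to a unimodular ternary lattice. *)
Theorem binary_unimod3_repr a b c : 0 < a -> 0 < det2 a b c -> unimod3_repr (herm2 a b c).
Proof.
have [i] := ubnP `|det2 a b c|%N; elim: i => // i IH in a b c *.
move=> mi a0 m0; have c0 := det2_gt0 a0 m0.
have refine : has_overlattice a b c -> unimod3_repr (herm2 a b c).
  case=> a' [b' [c' [R a'0 m'0 lt]]]; apply: unimod3_repr_trans R _; apply: IH => //; lia.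
have [/(overlattice_even a0 c0 m0)|d_odd] := boolP (2 %| det2 a b c)%Z; first exact: refine.
set D := `|det2 a b c|%N.
have DE : det2 a b c = D%:Z by rewrite /D gtz0_abs.
have odd_dvd (p : nat) : prime p -> (p %| D)%N -> odd p.
  move=> p_pr pD; apply: contraR d_odd => p_even.
  by rewrite DE dvdzE /=; apply: dvdn_trans pD; rewrite dvdn2.
have [/hasP[p]|/hasPn good_p] :=
  boolP (has (fun p => (p ^ 2 %| D)%N || content_dvd p a b c) (primes D)).
  rewrite mem_primes => /and3P[p_pr _ pD] /orP[p2|/and4P[pa pb0 pb1 pc]]; apply: refine.
    by apply: (overlattice_square p_pr (odd_dvd p p_pr pD)); rewrite // DE dvdzE abszX.
  exact: (overlattice_content p_pr (odd_dvd p p_pr pD)).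
have [|p p_pr pD|s [t /dvdzP[e eE]]] := @adj_form_solution a b c D.
- by rewrite /D absz_gt0; lia.
- have : p \in primes D by rewrite mem_primes p_pr pD /D absz_gt0; lia.
  move=> /good_p; rewrite negb_or => /andP[-> cont]; split=> //.
  exact: (adj_form_local p_pr (odd_dvd p p_pr pD)).
apply: unimod3_repr_trans (extend_repr a b c e s t) _; apply: unimodular3_class => //.
  by move: m0; rewrite /det2 /qnorm /= sqrrN.
have -> : det3 a c e (qconj b) s t = e * det2 a b c - adj_form a b c s t.
  by rewrite /det3 /adj_form /det2 /qnorm /=; ring.
by rewrite DE -eE; ring.
Qed.

(** * From I3 to <1,1> + M *)

Definition L4 : 'M[quadint]_4 := seqmx 4 4
  [:: [:: q1; q0; q0; q0];
      [:: q0; q1; q0; q0];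
      [:: q0; q0; Quad 2 0; Quad (-1) 1];
      [:: q0; q0; Quad (-1) (-1); Quad 2 0]].

Lemma L4_I1M : qrepresents L4 I1M.
Proof.
rewrite /L4 /I1M.
gram_ring ([:: [:: q0; q1; q0; q0]; [:: q0; q0; q1; q0]; [:: q0; q0; q0; q1]]).
Qed.

Definition I3_gram x1 x2 x3 y1 y2 y3 :=
  herm2 (qnorm x1 + qnorm x2 + qnorm x3)
        (qadd (qadd (cross x1 y1) (cross x2 y2)) (cross x3 y3))
        (qnorm y1 + qnorm y2 + qnorm y3).

Lemma L4_plane x1 x2 y1 y2 :
  qrepresents L4 (herm2 (qnorm x1 + qnorm x2) (qadd (cross x1 y1) (cross x2 y2))
                        (qnorm y1 + qnorm y2)).
Proof.
rewrite /L4 /herm2 /qnorm /cross.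
gram_ring ([:: [:: x1; x2; q0; q0]; [:: y1; y2; q0; q0]]).
Qed.

(** Divisibility by pi = 1 + w: modulo pi, w is -1 and O/pi is F_3. *)
Definition pi_dvd z := (3 %| qre z - qim z)%Z.

Lemma pi_dvdP z : reflect (exists w, z = qmul (Quad 1 1) w) (pi_dvd z).
Proof.
apply: (iffP idP) => [/dvdzP[q qE]|[w ->]]; last first.
  by apply/dvdzP; exists (- qim w); rewrite /=; ring.
exists (Quad (q + qim z) (- q)); apply: quad_eq => /=; lia.
Qed.

(** With x1 + x2 + x3 = pi u, the vector (x1, x2, x3) is u (1,1,1)/conj(pi)
    + (x1 - x3) m1 + (u - conj(pi) x3) m2, where m1 = (1,-1,0) and
    m2 = (-1,2,-1)/conj(pi) span a copy of M orthogonal to (1,1,1). *)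
Lemma neighbour x1 x2 x3 x4 y1 y2 y3 y4 :
    pi_dvd (qadd (qadd x1 x2) x3) -> pi_dvd (qadd (qadd y1 y2) y3) ->
  qrepresents L4 (herm2 (qnorm x1 + qnorm x2 + qnorm x3 + qnorm x4)
     (qadd (qadd (qadd (cross x1 y1) (cross x2 y2)) (cross x3 y3)) (cross x4 y4))
     (qnorm y1 + qnorm y2 + qnorm y3 + qnorm y4)).
Proof.
move=> /pi_dvdP[u uE] /pi_dvdP[v vE].
have -> : x2 = qadd (qmul (Quad 1 1) u) (qopp (qadd x1 x3)).
  by rewrite -uE; apply: quad_eq => /=; ring.
have -> : y2 = qadd (qmul (Quad 1 1) v) (qopp (qadd y1 y3)).
  by rewrite -vE; apply: quad_eq => /=; ring.
rewrite /L4 /herm2 /qnorm /cross.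
gram_ring ([:: [:: x4; u; qadd x1 (qopp x3); qadd u (qopp (qmul (Quad 1 (-1)) x3))];
              [:: y4; v; qadd y1 (qopp y3); qadd v (qopp (qmul (Quad 1 (-1)) y3))]]).
Qed.

(** Multiplication by conj(pi)/pi keeps norms and products, and a nonzero
    pair divisible by pi becomes one that is divisible by pi once less. *)
Lemma strip_pi x y : exists x' y',
  [/\ qnorm x' = qnorm x, qnorm y' = qnorm y, cross x' y' = cross x y &
      (x' = 0 /\ y' = 0) \/ ~~ (pi_dvd x' && pi_dvd y')].
Proof.
have [n] := ubnP `|(qnorm x + qnorm y)%R|%N; elim: n => // n IH in x y *.
move=> lt.
have [/andP[/pi_dvdP[u uE] /pi_dvdP[v vE]]|nd] := boolP (pi_dvd x && pi_dvd y); last first.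
  by exists x, y; split=> //; right.
have normE w : qnorm (qmul (Quad 1 1) w) = 3 * qnorm w by rewrite /qnorm /=; ring.
have normE' w : qnorm (qmul (Quad 1 (-1)) w) = 3 * qnorm w by rewrite /qnorm /=; ring.
have n0 : qnorm 0 = 0 by [].
have [x0|x0] := eqVneq (qnorm x + qnorm y) 0.
  have := qnorm_ge0 x; have := qnorm_ge0 y => y_ge0 x_ge0.
  have /qnorm_eq0 -> : qnorm x = 0 by lia.
  have /qnorm_eq0 -> : qnorm y = 0 by lia.
  by exists 0, 0; split=> //; left.
have [|u' [v' [uN vN uv [[u0 v0]|nd]]]] := IH u v.
- have := qnorm_ge0 u; have := qnorm_ge0 v; have := normE u; have := normE v.
  by rewrite -uE -vE; lia.
- exists 0, 0; split; last by left.
  + by rewrite uE normE -uN u0 n0 mulr0.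
  + by rewrite vE normE -vN v0 n0 mulr0.
  + have -> : cross x y = qmul (Quad 3 0) (cross u v).
      by rewrite uE vE; apply: quad_eq => /=; ring.
    by rewrite -uv u0 v0; apply: quad_eq.
exists (qmul (Quad 1 (-1)) u'), (qmul (Quad 1 (-1)) v'); split.
- by rewrite normE' uE normE uN.
- by rewrite normE' vE normE vN.
- transitivity (qmul (Quad 3 0) (cross u' v')); first by apply: quad_eq => /=; ring.
  by rewrite uv uE vE; apply: quad_eq => /=; ring.
right; apply: contra nd; rewrite /pi_dvd /=; lia.
Qed.

Lemma herm2_I3 a b c : qrepresents I3 (herm2 a b c) -> exists x1 x2 x3 y1 y2 y3,
  [/\ a = qnorm x1 + qnorm x2 + qnorm x3, c = qnorm y1 + qnorm y2 + qnorm y3 &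
      b = qadd (qadd (cross x1 y1) (cross x2 y2)) (cross x3 y3)].
Proof.
case=> X; have -> : I3 = 1%:M.
  by apply/matrixP; do 2![case=> [[|[|[|?]]] ?] //]; rewrite !mxE.
rewrite mulmx1 => /matrixP E.
have EE i j : (X *m conjtr X) i j
    = qadd (qadd (cross (X i 0) (X j 0)) (cross (X i 1) (X j 1))) (cross (X i 2%:R) (X j 2%:R)).
  rewrite !mxE !big_ord_recl big_ord0 !mxE.
  have -> : lift ord0 ord0 = 1 :> 'I_3 by apply: val_inj.
  have -> : lift ord0 (lift ord0 ord0) = 2%:R :> 'I_3 by apply: val_inj.
  by rewrite addr0 addrA.
exists (X 0 0), (X 0 1), (X 0 2%:R), (X 1 0), (X 1 1), (X 1 2%:R).
move: (E 0 0) (E 0 1) (E 1 1); rewrite !EE !mxE /= => Ea -> Ec; split=> //.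
- by move/(congr1 qre): Ea; rewrite /= /qnorm => ->; ring.
- by move/(congr1 qre): Ec; rewrite /= /qnorm => ->; ring.
Qed.

Definition pi_residue z := `|((qre z - qim z) %% 3)%Z|%N.

Definition F3_vectors : seq (nat * nat) :=
  [seq v <- [seq (r, s) | r <- iota 0 3, s <- iota 0 3] | v != (0, 0)%N].

Definition F3_relations : seq (int * int * int) :=
  [:: (1, 1, 0); (1, -1, 0); (1, 0, 1); (1, 0, -1); (0, 1, 1); (0, 1, -1);
      (1, 1, 1); (1, 1, -1); (1, -1, 1); (1, -1, -1)].

Definition F3_zero (c : int * int * int) (r1 r2 r3 : nat) :=
  (3 %| c.1.1 * r1%:Z + c.1.2 * r2%:Z + c.2 * r3%:Z)%Z.

(** Three nonzero vectors of F_3^2: two of them are equal up to sign, or each two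
    are independent and the third is a combination of them with nonzero
    coefficients.  The finitely many cases are checked by computation. *)
Lemma F3_relation u v w : u \in F3_vectors -> v \in F3_vectors -> w \in F3_vectors ->
  exists2 c, c \in F3_relations & F3_zero c u.1 v.1 w.1 && F3_zero c u.2 v.2 w.2.
Proof.
have: all (fun u => all (fun v => all (fun w =>
        has (fun c => F3_zero c u.1 v.1 w.1 && F3_zero c u.2 v.2 w.2) F3_relations)
        F3_vectors) F3_vectors) F3_vectors by vm_compute.
by move=> /allP H /H{}H; move: H => /allP H /H{}H; move: H => /allP H /H /hasP.
Qed.

Definition lin_comb (c : int * int * int) x y z :=
  qadd (qadd (scale c.1.1 x) (scale c.1.2 y)) (scale c.2 z).

Lemma pi_dvd_lin_comb c x y z :
  F3_zero c (pi_residue x) (pi_residue y) (pi_residue z) = pi_dvd (lin_comb c x y z).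
Proof.
have resE u : (pi_residue u)%:Z = qre u - qim u - ((qre u - qim u) %/ 3)%Z * 3.
  by rewrite /pi_residue; lia.
case: c => [[c1 c2] c3]; rewrite /F3_zero /pi_dvd /lin_comb /scale !resE /=.
set X := ((qre x - _) %/ 3)%Z; set Y := ((qre y - _) %/ 3)%Z; set Z := ((qre z - _) %/ 3)%Z.
have -> : c1 * (qre x - qim x - X * 3) + c2 * (qre y - qim y - Y * 3) 
            + c3 * (qre z - qim z - Z * 3)
   = c1 * (qre x - qim x) + c2 * (qre y - qim y) + c3 * (qre z - qim z)
     + - (c1 * X + c2 * Y + c3 * Z) * 3 by ring.
have d3 : (3 %| - (c1 * X + c2 * Y + c3 * Z) * 3)%Z by rewrite dvdz_mull.
rewrite (rpredDr _ d3); apply: (congr1 (fun t => (3 %| t)%Z)); ring.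
Qed.

Lemma pi_residue_vector x y : ~~ (pi_dvd x && pi_dvd y) ->
  (pi_residue x, pi_residue y) \in F3_vectors.
Proof.
rewrite /pi_dvd => nd; rewrite mem_filter; apply/andP; split.
  by apply: contra nd; rewrite xpair_eqE /pi_residue; lia.
have lt3 z : pi_residue z \in iota 0 3 by rewrite mem_iota /pi_residue; lia.
exact: allpairs_f.
Qed.

Lemma neighbour3 e1 e2 e3 x1 x2 x3 y1 y2 y3 : e1 ^+ 2 = 1 -> e2 ^+ 2 = 1 -> e3 ^+ 2 = 1 ->
    pi_dvd (lin_comb (e1, e2, e3) x1 x2 x3) -> pi_dvd (lin_comb (e1, e2, e3) y1 y2 y3) ->
  qrepresents L4 (I3_gram x1 x2 x3 y1 y2 y3).
Proof.
move=> e1E e2E e3E dx dy; have := neighbour q0 q0 dx dy.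
rewrite !qnorm_scale // !cross_scale // /=.
rewrite /I3_gram; congr (qrepresents _ (herm2 _ _ _)); first by rewrite /qnorm /=; ring.
  by apply: quad_eq => /=; ring.
by rewrite /qnorm /=; ring.
Qed.

Lemma neighbour2 e1 e2 x1 x2 x3 y1 y2 y3 : e1 ^+ 2 = 1 -> e2 ^+ 2 = 1 ->
    pi_dvd (lin_comb (e1, e2, 0) x1 x2 x3) -> pi_dvd (lin_comb (e1, e2, 0) y1 y2 y3) ->
  qrepresents L4 (I3_gram x1 x2 x3 y1 y2 y3).
Proof.
move=> e1E e2E dx dy; have := neighbour x3 y3 dx dy.
rewrite !(qnorm_scale _ e1E, qnorm_scale _ e2E) !(cross_scale _ _ e1E, cross_scale _ _ e2E) /=.
rewrite /I3_gram; congr (qrepresents _ (herm2 _ _ _)); first by rewrite /qnorm /=; ring.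
  by apply: quad_eq => /=; ring.
by rewrite /qnorm /=; ring.
Qed.

Lemma L4_I3 a b c : qrepresents I3 (herm2 a b c) -> qrepresents L4 (herm2 a b c).
Proof.
case/herm2_I3 => [x1 [x2 [x3 [y1 [y2 [y3 [-> -> ->]]]]]]].
have [u1 [v1 [<- <- <- S1]]] := strip_pi x1 y1.
have [u2 [v2 [<- <- <- S2]]] := strip_pi x2 y2.
have [u3 [v3 [<- <- <- S3]]] := strip_pi x3 y3.
have n0 : qnorm 0 = 0 by [].
have c0 : cross 0 0 = 0 by apply: quad_eq.
have z1 : qadd 0 =1 id by exact: add0r.
have z2 x : qadd x 0 = x by exact: addr0.
case: S1 => [[-> ->]|S1]; first by rewrite n0 c0 z1 !add0r; apply: L4_plane.
case: S2 => [[-> ->]|S2]; first by rewrite n0 c0 z2 !addr0; apply: L4_plane.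
case: S3 => [[-> ->]|S3]; first by rewrite n0 c0 z2 !addr0; apply: L4_plane.
have [rel cR] :=
  F3_relation (pi_residue_vector S1) (pi_residue_vector S2) (pi_residue_vector S3).
rewrite /= !pi_dvd_lin_comb => /andP[].
have comb13 e x y z : lin_comb (1, 0, e) x y z = lin_comb (1, e, 0) x z y.
  by apply: quad_eq => /=; ring.
have comb23 e x y z : lin_comb (0, 1, e) x y z = lin_comb (1, e, 0) y z x.
  by apply: quad_eq => /=; ring.
have case13 e : e ^+ 2 = 1 ->
    pi_dvd (lin_comb (1, 0, e) u1 u2 u3) -> pi_dvd (lin_comb (1, 0, e) v1 v2 v3) ->
    qrepresents L4 (I3_gram u1 u2 u3 v1 v2 v3).
  move=> eE; rewrite !comb13 => dx dy; have := neighbour2 (expr1n _ _) eE dx dy.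
  rewrite /I3_gram.
  by congr (qrepresents _ (herm2 _ _ _)); [ring | apply: quad_eq => /=; ring | ring].
have case23 e : e ^+ 2 = 1 ->
    pi_dvd (lin_comb (0, 1, e) u1 u2 u3) -> pi_dvd (lin_comb (0, 1, e) v1 v2 v3) ->
    qrepresents L4 (I3_gram u1 u2 u3 v1 v2 v3).
  move=> eE; rewrite !comb23 => dx dy; have := neighbour2 (expr1n _ _) eE dx dy.
  rewrite /I3_gram.
  by congr (qrepresents _ (herm2 _ _ _)); [ring | apply: quad_eq => /=; ring | ring].
move: cR; rewrite !inE; do 9?[case/predU1P=> [->|]]; last move/eqP->.
- exact: neighbour2.
- exact: neighbour2.
- exact: case13.
- exact: case13.
- exact: case23.
- exact: case23.
all: exact: neighbour3.
Qed.

Theorem L4_universal a b c : 0 < a -> 0 < det2 a b c -> qrepresents L4 (herm2 a b c).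
Proof.
move=> a0 m0; case: (binary_unimod3_repr a0 m0) => [/L4_I3 //|].
exact: qrepresents_trans L4_I1M.
Qed.

(** * Embedding in the complex numbers *)

Local Open Scope sesquilinear_scope.

Lemma sqrtm2_sqr : sqrtm2 ^+ 2 = - 2.
Proof. exact: sqrtCK. Qed.

(** The conjugate is a square root of -2 as well, and not w, which is not real. *)
Lemma conj_sqrtm2 : sqrtm2^* = - sqrtm2.
Proof.
have /eqP : (sqrtm2^*) ^+ 2 = sqrtm2 ^+ 2.
  by rewrite -rmorphXn /= sqrtm2_sqr rmorphN rmorph_nat.
rewrite eqf_sqr => /orP[/eqP/CrealP w_real|/eqP //].
have := real_exprn_even_ge0 w_real (isT : ~~ odd 2).
by rewrite sqrtm2_sqr oppr_ge0 lern0.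
Qed.

Definition embed (z : quadint) : algC := (qre z)%:~R + (qim z)%:~R * sqrtm2.

Fact embed_is_zmod_morphism : zmod_morphism embed.
Proof.
by move=> x y; rewrite -[x - y]/(qadd x (qopp y)) /embed /= !rmorphD !rmorphN; ring.
Qed.

Fact embed_is_monoid_morphism : monoid_morphism embed.
Proof.
split=> [|x y]; first by rewrite /embed /= mul0r addr0.
rewrite -[x * y]/(qmul x y) /embed /=.
transitivity ((qre x)%:~R * (qre y)%:~R + sqrtm2 ^+ 2 * ((qim x)%:~R * (qim y)%:~R)
  + ((qre x)%:~R * (qim y)%:~R + (qim x)%:~R * (qre y)%:~R) * sqrtm2); last by ring.
by rewrite sqrtm2_sqr; ring.
Qed.
HB.instance Definition _ :=
  GRing.isZmodMorphism.Build quadint algC embed embed_is_zmod_morphism.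
HB.instance Definition _ :=
  GRing.isMonoidMorphism.Build quadint algC embed embed_is_monoid_morphism.

Lemma embed_conj z : embed (qconj z) = (embed z)^*.
Proof.
by rewrite /embed /= rmorphD rmorphM /= conj_sqrtm2 !rmorph_int mulrNz mulNr mulrN.
Qed.

Lemma Zsqrtm2P (x : algC) : reflect (exists z, x = embed z) (x \in Zsqrtm2).
Proof.
apply: (iffP (Cint_spanP [tuple 1; sqrtm2] x)) => [[a ->]|[z ->]].
  exists (Quad (a ord0) (a ord_max)); rewrite big_ord_recl big_ord1 /embed /=.
  rewrite -[sqrtm2 *~ _]mulrzl; congr (_ + (a _)%:~R * _); exact: val_inj.
exists [ffun i => if i == ord0 then qre z else qim z].
by rewrite big_ord_recl big_ord1 /embed /= !ffunE /= -[sqrtm2 *~ _]mulrzl.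
Qed.

Lemma mxOver_Zsqrtm2P m n (A : 'M[algC]_(m, n)) :
  reflect (exists B, A = map_mx embed B) (A \is a mxOver Zsqrtm2).
Proof.
apply: (iffP mxOverP) => [AO|[B ->] i j]; last first.
  by rewrite mxE; apply/Zsqrtm2P; exists (B i j).
have inv (x : algC) : x \in Zsqrtm2 -> {z | x = embed z}.
  by move=> /Zsqrtm2P/sig_eqW.
exists (\matrix_(i, j) sval (inv _ (AO i j))); apply/matrixP => i j; rewrite !mxE.
by case: (inv _ _).
Qed.

Lemma map_embed_conj m n (B : 'M[quadint]_(m, n)) :
  (map_mx embed B)^t* = map_mx embed (conjtr B).
Proof. by apply/matrixP => i j; rewrite !mxE embed_conj. Qed.

Lemma represents_map m n (L : 'M[quadint]_m) (l : 'M[quadint]_n) :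
  qrepresents L l -> represents (map_mx embed L) (map_mx embed l).
Proof.
case=> X ->; exists (map_mx embed X); first by apply/mxOver_Zsqrtm2P; exists X.
by rewrite map_embed_conj -!map_mxM.
Qed.

Lemma L4E :
  orthogonal_sum (diag_lattice [:: 1; 1])
                 (mx22 2 (- 1 + sqrtm2) (- 1 - sqrtm2) 2) = map_mx embed L4.
Proof.
rewrite /orthogonal_sum /diag_lattice /L4.
have e0 : embed q0 = 0 by exact: rmorph0.
have e1 : embed q1 = 1 by exact: rmorph1.
have e2 : embed (Quad 2 0) = 2 by rewrite /embed /= mul0r addr0.
rewrite -[RHS](@submxK _ 2 2 2 2) -!map_ulsubmx -!map_ursubmx -!map_dlsubmx -!map_drsubmx.
congr block_mx; apply/matrixP; do 2![case=> [[|[|?]] ?] //].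
all: rewrite !mxE /= ?e0 ?e1 ?e2 //.
all: by rewrite /embed /= ?mulN1r ?mul1r.
Qed.

Lemma embed_int n : embed (Quad n 0) = n%:~R.
Proof. by rewrite /embed /= mul0r addr0. Qed.

Lemma embed_inj : injective embed.
Proof.
apply: raddf_inj => z z0; apply: qnorm_eq0.
have : embed (z * qconj z) = (qnorm z)%:~R.
  have -> : z * qconj z = Quad (qnorm z) 0 by apply: quad_eq; rewrite /qnorm /=; ring.
  exact: embed_int.
by rewrite rmorphM z0 mul0r => /eqP; rewrite eq_sym intr_eq0 => /eqP.
Qed.

Lemma hform_gram m (L : seq (seq quadint)) u :
    size L = m -> all (fun r => size r == m) L -> size u = m ->
  hform (map_mx embed (seqmx m m L))
        (map_mx embed (seqmx 1 m [:: u])) (map_mx embed (seqmx 1 m [:: u]))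
    = embed (sesq L u u).
Proof.
move=> sL aL su; rewrite /hform map_embed_conj -!map_mxM -gram_mx ?mxE //=.
by rewrite su eqxx.
Qed.

Lemma map_embed_inj m n : injective (fun A : 'M[quadint]_(m, n) => map_mx embed A).
Proof.
move=> A B /matrixP E; apply/matrixP => i j; apply: embed_inj.
by have := E i j; rewrite !mxE.
Qed.

Lemma hermitian_map n (G : 'M[quadint]_n) :
  (map_mx embed G \is hermsymmx) = (G == conjtr G).
Proof.
rewrite is_hermitianmxE expr0 scale1r map_embed_conj.
exact: (inj_eq (@map_embed_inj n n)).
Qed.

Lemma herm2_eq (G : 'M[quadint]_2) : G = conjtr G ->
  G = herm2 (qre (G 0 0)) (G 0 1) (qre (G 1 1)).
Proof.
move=> /matrixP GE; apply/matrixP; do 2![case=> [[|[|?]] ?] //]; rewrite !mxE /=.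
- have := GE 0 0; rewrite !mxE => /(congr1 qim) /= G0.
  rewrite (_ : G _ _ = G 0 0); last by congr (G _ _); apply: val_inj.
  by apply: quad_eq => //=; move: G0; lia.
- by congr (G _ _); apply: val_inj.
- by have := GE 1 0; rewrite !mxE => <-; congr (G _ _); apply: val_inj.
have := GE 1 1; rewrite !mxE => /(congr1 qim) /= G1.
rewrite (_ : G _ _ = G 1 1); last by congr (G _ _); apply: val_inj.
by apply: quad_eq => //=; move: G1; lia.
Qed.

Lemma row4_eta (u : 'rV[quadint]_4) :
  u = seqmx 1 4 [:: [:: u 0 0; u 0 1; u 0 2%:R; u 0 3%:R]].
Proof.
apply/rowP; case=> [[|[|[|[|?]]]] ?] //; rewrite !mxE /=; congr (u _ _); exact: val_inj.
Qed.

(** Twice the form is a sum of norms, by completing the square on M. *)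
Lemma L4_positive : positive_lattice (map_mx embed L4).
Proof.
split; first split.
- by apply/mxOver_Zsqrtm2P; exists L4.
- rewrite hermitian_map; apply/eqP/matrixP.
  by do 2![case=> [[|[|[|[|?]]]] ?] //]; rewrite !mxE.
move=> x /mxOver_Zsqrtm2P[u ->] u0.
rewrite (row4_eta u) hform_gram //.
have : [|| u 0 0 != 0, u 0 1 != 0, u 0 2%:R != 0 | u 0 3%:R != 0].
  apply: contraR u0; rewrite !negb_or !negbK => /and4P[/eqP u0 /eqP u1 /eqP u2 /eqP u3].
  rewrite (row4_eta u) u0 u1 u2 u3; apply/eqP/rowP.
  by case=> [[|[|[|[|?]]]] ?] //; rewrite !mxE rmorph0.
move: (u 0 0) (u 0 1) (u 0 2%:R) (u 0 3%:R) => x0 x1 x2 x3 xn0.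
set v := sesq _ _ _; pose h := qre v.
rewrite (_ : v = Quad h 0); last by apply: quad_eq => //=; ring.
rewrite embed_int ltr0z.
have hE : 2 * h = 2 * qnorm x0 + 2 * qnorm x1
                + qnorm (qadd (qmul (Quad 2 0) x2) (qmul (Quad (-1) (-1)) x3)) + qnorm x3.
  by rewrite /h /v /qnorm /=; ring.
have n0 := qnorm_ge0 x0; have n1 := qnorm_ge0 x1; have n3 := qnorm_ge0 x3.
have n2 := qnorm_ge0 (qadd (qmul (Quad 2 0) x2) (qmul (Quad (-1) (-1)) x3)).
clearbody h; rewrite lt_neqAle; apply/andP; split; last by lia.
apply: contraL xn0 => /eqP h0.
have /qnorm_eq0 -> : qnorm x0 = 0 by lia.
have /qnorm_eq0 -> : qnorm x1 = 0 by lia.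
have /qnorm_eq0 x30 : qnorm x3 = 0 by lia.
have /qnorm_eq0 : qnorm (qadd (qmul (Quad 2 0) x2) (qmul (Quad (-1) (-1)) x3)) = 0 by lia.
rewrite x30 => x20; have -> : x2 = 0.
  by apply: quad_eq; [have := congr1 qre x20 | have := congr1 qim x20]; rewrite /=; lia.
by rewrite !eqxx.
Qed.

(** The norms of e0 and of a e1 - conj(b) e0, which is orthogonal to e0, are a and
    a * det2 a b c. *)
Lemma herm2_positive a b c : positive_lattice (map_mx embed (herm2 a b c)) ->
  0 < a /\ 0 < det2 a b c.
Proof.
case=> _ pos.
have Opos s t (h : int) : t != 0 \/ s != 0 ->
    sesq [:: [:: Quad a 0; b]; [:: qconj b; Quad c 0]] [:: s; t] [:: s; t] = Quad h 0 ->
    0 < h.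
  move=> st hE; have := pos (map_mx embed (seqmx 1 2 [:: [:: s; t]])).
  rewrite hform_gram // hE embed_int ltr0z; apply.
    by apply/mxOver_Zsqrtm2P; eexists.
  apply/eqP => /matrixP E; have := E 0 0; have := E 0 1; rewrite !mxE /= -(rmorph0 embed).
  by move=> /embed_inj t0 /embed_inj s0; case: st; rewrite ?t0 ?s0 eqxx.
have a0 : 0 < a by apply: (Opos q1 q0); [right | apply: quad_eq => /=; ring].
split=> //; rewrite -(pmulr_rgt0 _ a0).
apply: (Opos (qopp (qconj b)) (Quad a 0)).
  by left; apply: contraTneq a0 => -[->].
by apply: quad_eq; rewrite /det2 /qnorm /=; ring.
Qed.

Theorem theorem6 :
  two_universal
    (orthogonal_sum (diag_lattice [:: 1; 1])
                    (mx22 2 (- 1 + sqrtm2) (- 1 - sqrtm2) 2)).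
Proof.
rewrite L4E; split; first exact: L4_positive.
move=> l lpos; have [[/mxOver_Zsqrtm2P[G lE] lherm] _] := lpos.
rewrite lE hermitian_map in lherm; rewrite {}lE in lpos *.
rewrite (herm2_eq (eqP lherm)) in lpos *.
have [a0 m0] := herm2_positive lpos.
exact/represents_map/L4_universal.
Qed.
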